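(* Let $A$ be an affine algebra over a field $K$. Then for any non-zero-divisor $f$ in $A$, $\dim A[1/f]=\dim A$.
   Context: All rings and algebras are commutative with identity $\neq 0$. An affine algebra over $K$ is a finitely generated $K$-algebra, i.e. one of the form $K[X_1,\dots,X_n]/I$. $\dim$ denotes Krull dimension. $A[1/f]$ is the localization of $A$ at the multiplicatively closed set $\{f^t : t\geq 0\}$. *)

(* Defs.v *)
From HB Require Import structures.
From mathcomp Require Import all_boot all_order all_algebra.
From mathcomp Require Import ring_quotient generic_quotient.
(* mpoly has to be imported before boolp/classical_sets: in the opposite order
   the notations of the two libraries clash. *)
From mathcomp Require Import mpoly.
From mathcomp Require Import boolp classical_sets constructive_ereal.
From mathcomp Require Import ring.

Set Implicit Arguments.
Unset Strict Implicit.
Unset Printing Implicit Defensive.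

Import Order.TTheory GRing.Theory Num.Theory.

Local Open Scope classical_set_scope.
Local Open Scope quotient_scope.
Local Open Scope ring_scope.

(* A is of the form K[X_1, ..., X_n]/I, i.e. a K-algebra quotient of some
   K[X_1, ..., X_n]; I is the kernel of phi. *)
Definition affine_algebra (K : fieldType) (A : comAlgType K) : Prop :=
  exists (n : nat) (phi : {lrmorphism {mpoly K[n]} -> A}),
    forall a : A, exists p : {mpoly K[n]}, phi p = a.

(* A chain P_0 < P_1 < ... < P_n has length n. An element of prime_idealr R is a
   boolean predicate, but by excluded middle (boolp) every subset of R is one. *)
Definition prime_chain (R : comNzRingType) (n : nat)
    (P : 'I_n.+1 -> prime_idealr R) : Prop :=
  forall i j : 'I_n.+1, (i < j)%N ->
    {subset P i <= P j} /\ ~ {subset P j <= P i}.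

Definition chain_lengths (R : comNzRingType) : set (\bar int) :=
  [set d | exists (n : nat) (P : 'I_n.+1 -> prime_idealr R),
             prime_chain P /\ d = (n%:Z)%:E].

(* Every subset of \bar int contained in the naturals has a supremum in \bar int,
   so the default value -oo is only used if R has no prime ideal at all, which
   cannot happen since R is not the zero ring; see krull_dim_supremum. *)
Definition krull_dim (R : comNzRingType) : \bar int :=
  supremum (-oo)%E (chain_lengths R).

Lemma krull_dim_supremum (R : comNzRingType) :
  chain_lengths R !=set0 -> supremums (chain_lengths R) (krull_dim R).
Proof.
move=> ne; rewrite /krull_dim /supremum ifF; last exact/negbTE/set0P.
suff exS : supremums (chain_lengths R) !=set0 by exact: xgetPex.
pose N := [set n : nat | chain_lengths R (n%:Z)%:E].
have [[m ubm]|nub] := pselect (ubound N !=set0).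
  have [s [ubs lubs]] : supremums N !=set0.
    by apply: nat_supremums_neq0; exists m.
  exists (s%:Z)%:E; split.
    move=> d Sd; have [n [P [cP dE]]] := Sd.
    by rewrite dE lee_fin lez_nat; apply: ubs; rewrite /N /= -dE.
  move=> d ubd; have [d0 Sd0] := ne.
  case: d ubd => [z| |] ubd; last 2 first.
  - exact: leey.
  - by have := ubd _ Sd0; have [n [P [_ ->]]] := Sd0.
  have z0 : 0 <= z.
    have := ubd _ Sd0; have [n [P [_ ->]]] := Sd0.
    by rewrite lee_fin; apply: le_trans.
  rewrite lee_fin -(gez0_abs z0) lez_nat; apply: lubs => k Nk.
  by have := ubd _ Nk; rewrite lee_fin -{1}(gez0_abs z0) lez_nat.
exists (+oo)%E; split=> [d _|d ubd]; first exact: leey.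
case: d ubd => [z| |] ubd //.
  exfalso; apply: nub; exists `|z|%N => k Nk.
  have := ubd _ Nk; rewrite lee_fin => kz.
  have z0 : 0 <= z by apply: le_trans kz.
  by rewrite -(gez0_abs z0) lez_nat in kz.
by have [d0 Sd0] := ne; have := ubd _ Sd0; have [n [P [_ ->]]] := Sd0.
Qed.

Definition nonnilpotent (R : comNzRingType) (f : R) : Prop :=
  forall t : nat, f ^+ t != 0.

Lemma non_zero_divisor_nonnilpotent (R : comNzRingType) (f : R) :
  (forall a : R, f * a = 0 -> a = 0) -> nonnilpotent f.
Proof.
move=> hf; elim=> [|t IHt]; first by rewrite expr0 oner_neq0.
by apply/eqP; rewrite exprS => /hf /eqP; apply/negP.
Qed.

(* The localization R[1/f] at {f ^ t : t >= 0}; the pair (a, t) stands for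
   a / f ^ t. The hypothesis on f says exactly that R[1/f] is not the zero
   ring. *)
Section Away.
Variables (R : comNzRingType) (f : R) (hf : nonnilpotent f).

Implicit Types x y z : R * nat.

Definition away_equivf x y : bool :=
  `[< exists s : nat, f ^+ s * (f ^+ y.2 * x.1 - f ^+ x.2 * y.1) = 0 >].

Lemma away_equivfP x y : reflect
  (exists s : nat, f ^+ s * (f ^+ y.2 * x.1 - f ^+ x.2 * y.1) = 0)
  (away_equivf x y).
Proof. exact: asboolP. Qed.

Lemma away_equivf_refl : reflexive away_equivf.
Proof. by move=> x; apply/away_equivfP; exists 0%N; rewrite subrr mulr0. Qed.

Lemma away_equivf_sym : ssrbool.symmetric away_equivf.
Proof.
by move=> x y; apply/away_equivfP/away_equivfP => -[s hs]; exists s;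
  rewrite -opprB mulrN hs oppr0.
Qed.

Lemma away_equivf_trans : transitive away_equivf.
Proof.
move=> y x z /away_equivfP[s hs] /away_equivfP[t ht]; apply/away_equivfP.
exists (s + t + y.2)%N; rewrite !exprD.
have -> : f ^+ s * f ^+ t * f ^+ y.2 * (f ^+ z.2 * x.1 - f ^+ x.2 * z.1) =
    f ^+ t * f ^+ z.2 * (f ^+ s * (f ^+ y.2 * x.1 - f ^+ x.2 * y.1)) +
    f ^+ s * f ^+ x.2 * (f ^+ t * (f ^+ z.2 * y.1 - f ^+ y.2 * z.1)) by ring.
by rewrite hs ht !mulr0 addr0.
Qed.

Canonical away_equivf_equiv :=
  EquivRel away_equivf away_equivf_refl away_equivf_sym away_equivf_trans.

(* hf is a phantom argument: the carrier does not depend on it, but the proof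
   that 1 != 0 in its canonical ring structure does. *)
Definition away_type (_ : nonnilpotent f) := {eq_quot away_equivf}.
Local Notation T := (away_type hf).

HB.instance Definition _ : EqQuotient _ away_equivf T := EqQuotient.on T.
HB.instance Definition _ := Choice.on T.

Definition away_frac (a : R) (t : nat) : T := \pi_T (a, t).

Lemma away_frac_eq (a b : R) (m n : nat) : away_frac a m = away_frac b n <->
  exists s : nat, f ^+ s * (f ^+ n * a - f ^+ m * b) = 0.
Proof.
rewrite /away_frac; split=> [/eqP|h]; first by rewrite eqmodE => /away_equivfP.
by apply/eqP; rewrite eqmodE; apply/away_equivfP.
Qed.

Lemma away_fracW (Q : T -> Prop) :
  (forall a t, Q (away_frac a t)) -> forall u, Q u.
Proof. by move=> h; elim/quotW => -[a t]; apply: h. Qed.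

Definition away_addf x y : R * nat :=
  (f ^+ y.2 * x.1 + f ^+ x.2 * y.1, (x.2 + y.2)%N).
Definition away_oppf x : R * nat := (- x.1, x.2).
Definition away_mulf x y : R * nat := (x.1 * y.1, (x.2 + y.2)%N).

Definition away_add := lift_op2 T away_addf.
Definition away_opp := lift_op1 T away_oppf.
Definition away_mul := lift_op2 T away_mulf.

Lemma away_equivf_repr x : exists s : nat,
  f ^+ s * (f ^+ (repr (\pi_T x)).2 * x.1 - f ^+ x.2 * (repr (\pi_T x)).1) = 0.
Proof.
apply/away_equivfP; rewrite away_equivf_sym.
by have /eqP := reprK (\pi_T x); rewrite eqmodE.
Qed.

Lemma away_eq_pi x y : away_equivf x y -> \pi_T y = \pi_T x.
Proof. by rewrite away_equivf_sym => h; apply/eqP; rewrite eqmodE. Qed.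

Lemma away_addE a m b n : away_add (away_frac a m) (away_frac b n) =
  away_frac (f ^+ n * a + f ^+ m * b) (m + n).
Proof.
rewrite /away_frac; unlock away_add; apply/away_eq_pi/away_equivfP.
have [s /= hs] := away_equivf_repr (a, m).
have [t /= ht] := away_equivf_repr (b, n).
case: (repr (\pi_T (a, m))) hs => a' m' /= hs.
case: (repr (\pi_T (b, n))) ht => b' n' /= ht.
exists (s + t)%N; rewrite !exprD.
transitivity (f ^+ t * f ^+ n * f ^+ n' * (f ^+ s * (f ^+ m' * a - f ^+ m * a'))
  + f ^+ s * f ^+ m * f ^+ m' * (f ^+ t * (f ^+ n' * b - f ^+ n * b'))).
  by ring.
by rewrite hs ht !mulr0 addr0.
Qed.

Lemma away_oppE a m : away_opp (away_frac a m) = away_frac (- a) m.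
Proof.
rewrite /away_frac; unlock away_opp; apply/away_eq_pi/away_equivfP.
have [s /= hs] := away_equivf_repr (a, m).
case: (repr (\pi_T (a, m))) hs => a' m' /= hs.
by exists s; rewrite !mulrN -opprD mulrN hs oppr0.
Qed.

Lemma away_mulE a m b n : away_mul (away_frac a m) (away_frac b n) =
  away_frac (a * b) (m + n).
Proof.
rewrite /away_frac; unlock away_mul; apply/away_eq_pi/away_equivfP.
have [s /= hs] := away_equivf_repr (a, m).
have [t /= ht] := away_equivf_repr (b, n).
case: (repr (\pi_T (a, m))) hs => a' m' /= hs.
case: (repr (\pi_T (b, n))) ht => b' n' /= ht.
exists (s + t)%N; rewrite !exprD.
transitivity (f ^+ t * f ^+ n' * b * (f ^+ s * (f ^+ m' * a - f ^+ m * a'))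
  + f ^+ s * f ^+ m * a' * (f ^+ t * (f ^+ n' * b - f ^+ n * b'))).
  by ring.
by rewrite hs ht !mulr0 addr0.
Qed.

Lemma away_frac_congr a m b n :
  f ^+ n * a = f ^+ m * b -> away_frac a m = away_frac b n.
Proof. by move=> h; apply/away_frac_eq; exists 0%N; rewrite h subrr mulr0. Qed.

Lemma away_addA : associative away_add.
Proof.
elim/away_fracW=> a m; elim/away_fracW=> b n; elim/away_fracW=> c p.
by rewrite !away_addE; apply: away_frac_congr; rewrite !exprD; ring.
Qed.

Lemma away_addC : commutative away_add.
Proof.
elim/away_fracW=> a m; elim/away_fracW=> b n.
by rewrite !away_addE; apply: away_frac_congr; rewrite !exprD; ring.
Qed.

Lemma away_add0 : left_id (away_frac 0 0) away_add.
Proof.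
elim/away_fracW=> a m.
by rewrite away_addE; apply: away_frac_congr; rewrite !exprD; ring.
Qed.

Lemma away_addN : left_inverse (away_frac 0 0) away_opp away_add.
Proof.
elim/away_fracW=> a m; rewrite away_oppE away_addE.
by apply: away_frac_congr; rewrite !exprD; ring.
Qed.

HB.instance Definition _ :=
  GRing.isZmodule.Build T away_addA away_addC away_add0 away_addN.

Lemma away_mulA : associative away_mul.
Proof.
elim/away_fracW=> a m; elim/away_fracW=> b n; elim/away_fracW=> c p.
by rewrite !away_mulE; apply: away_frac_congr; rewrite !exprD; ring.
Qed.

Lemma away_mulC : commutative away_mul.
Proof.
elim/away_fracW=> a m; elim/away_fracW=> b n.
by rewrite !away_mulE; apply: away_frac_congr; rewrite !exprD; ring.
Qed.

Lemma away_mul1 : left_id (away_frac 1 0) away_mul.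
Proof.
elim/away_fracW=> a m.
by rewrite away_mulE; apply: away_frac_congr; rewrite !exprD; ring.
Qed.

Lemma away_mulD : left_distributive away_mul away_add.
Proof.
elim/away_fracW=> a m; elim/away_fracW=> b n; elim/away_fracW=> c p.
rewrite !(away_addE, away_mulE); apply: away_frac_congr.
by rewrite !exprD; ring.
Qed.

Lemma away_one_neq0 : away_frac 1 0 != away_frac 0 0.
Proof.
apply/eqP => /away_frac_eq[s]; rewrite expr0 !mul1r subr0 mulr1 => /eqP.
by apply/negP; apply: hf.
Qed.

HB.instance Definition _ :=
  GRing.Zmodule_isComNzRing.Build T
    away_mulA away_mulC away_mul1 away_mulD away_one_neq0.

Lemma away_fracD a m b n :
  away_frac a m + away_frac b n = away_frac (f ^+ n * a + f ^+ m * b) (m + n).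
Proof. exact: away_addE. Qed.

Lemma away_fracN a m : - away_frac a m = away_frac (- a) m.
Proof. exact: away_oppE. Qed.

Lemma away_fracM a m b n :
  away_frac a m * away_frac b n = away_frac (a * b) (m + n).
Proof. exact: away_mulE. Qed.

Lemma away_frac0 : away_frac 0 0 = 0. Proof. by []. Qed.

Lemma away_frac1 : away_frac 1 0 = 1. Proof. by []. Qed.

End Away.

Definition away (R : comNzRingType) (f : R) (hf : nonnilpotent f) :
  comNzRingType := away_type hf.

(* Main.v *)
(* Both dimensions are the largest number of elements of A that are
   algebraically independent over K. If P_0 < ... < P_n is a chain of primes and
   a_i is in P_i but not in P_(i-1), then a_1, ..., a_n are independent modulo
   P_0. As f is a non-zero-divisor, no f^k p(a) with p != 0 vanishes, so the a_i
   remain independent modulo some prime P not containing f.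
   Conversely, given such a P, extend the independent family to a maximal one,
   with last variable X, so that the generators of A and f are algebraic over
   R = D[X] modulo P. For a suitable nonzero g in R the generators are integral
   over R[1/g] and g lies in fA + P. Put u = 1 - X g. By integrality uA + P
   misses D \ {0}, so it lies in a prime Q that misses D \ {0}. Then Q
   strictly contains P and keeps all variables but X independent; and f is not
   in Q, since u and g are comaximal. Iterating gives a chain of primes that do
   not contain f, that is, a chain in A[1/f]. *)
Require Import Defs.
From HB Require Import structures.
From mathcomp Require Import all_boot all_order all_algebra.
From mathcomp Require Import ring_quotient generic_quotient mpoly.
From mathcomp Require Import boolp classical_sets constructive_ereal.
From mathcomp Require Import ring.

Set Implicit Arguments.
Unset Strict Implicit.
Unset Printing Implicit Defensive.

Import GRing.Theory.

Local Open Scope ring_scope.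
Local Open Scope quotient_scope.

(** * Prime ideals disjoint from a multiplicative set *)

Lemma prime_ideal_of_set (R : comNzRingType) (I : set R) :
  I 0 -> ~ I 1 -> (forall a x y, I x -> I y -> I (a * x + y)) ->
  (forall x y, I (x * y) -> I x \/ I y) ->
  exists P : prime_idealr R, forall x, x \in P <-> I x.
Proof.
move=> I0 I1 Ilin Iprime.
pose S : {pred R} := fun x => `[< I x >].
have SP x : x \in S <-> I x by rewrite unfold_in /S; split=> /asboolP.
have Sid : idealr_closed S.
  split; [exact/SP | by apply/negP => /SP | ].
  by move=> a x y /SP Ix /SP Iy; apply/SP/Ilin.
have Spr : prime_idealr_closed S.
  by move=> x y /SP/Iprime[]/SP ->; rewrite ?orbT.
pose idS := isIdealr.Build R S Sid.
pose prS := isPrimeIdealrClosed.Build R S Spr.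
by exists (HB.pack_for (prime_idealr R) S idS prS).
Qed.

(** By Zorn's lemma there is a largest ideal that contains [I] and misses [S], and such an ideal is
    prime. *)
Lemma prime_ideal_avoiding (R : comNzRingType) (I S : set R) :
  I 0 -> (forall a x y, I x -> I y -> I (a * x + y)) ->
  S 1 -> (forall x y, S x -> S y -> S (x * y)) ->
  (forall x, I x -> ~ S x) ->
  exists P : prime_idealr R,
    (forall x, I x -> x \in P) /\ (forall x, S x -> x \notin P).
Proof.
move=> I0 Ilin S1 SM IS.
(* [I] is added to every candidate because the union of the empty chain is empty, hence no ideal. *)
pose J (X : set R) := (X `|` I)%classic.
pose good (X : set R) := (forall a x y, J X x -> J X y -> J X (a * x + y)) /\
  forall x, J X x -> ~ S x.
have [|M [[Mlin MS] Mmax]] := @Zorn_bigcup _ good.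
  move=> F Fgood Ftot.
  set U := (\bigcup_(X in F) X)%classic.
  have JU x : J U x -> I x \/ exists2 X, F X & J X x.
    by case=> [[X FX Xx]|]; [right; exists X => //; left | left].
  have JUI X x : F X -> J X x -> J U x.
    by move=> FX [Xx|Ix]; [left; exists X | right].
  split=> [a x y|x /JU[/IS//|[X FX Xx]]]; last first.
    by case: (Fgood X FX) => _; apply.
  have lin2 X : F X -> J X x -> J X y -> J U (a * x + y).
    move=> FX Xx Xy; apply: (JUI X) => //.
    by case: (Fgood X FX) => h _; apply: h.
  move=> /JU[Ix|[X FX Xx]] /JU[Iy|[Y FY Yy]].
  - by right; apply: Ilin.
  - by apply: (lin2 Y) => //; right.
  - by apply: (lin2 X) => //; right.
  - have [XY|YX] := Ftot X Y FX FY.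
      by apply: (lin2 Y) => //; case: Xx => [/XY|]; [left|right].
    by apply: (lin2 X) => //; case: Yy => [/YX|]; [left|right].
have J0 : J M 0 by right.
have JD x y : J M x -> J M y -> J M (x + y).
  by move=> Mx My; rewrite -[x]mul1r; apply: Mlin.
have JM a x : J M x -> J M (a * x).
  by move=> Mx; rewrite -[_ * _]addr0; apply: Mlin.
(* By maximality, adjoining an element outside the ideal produces an element
   of S. *)
have meet x : ~ J M x -> exists s a m, [/\ S s, J M m & s = a * x + m].
  move=> nx; apply: contrapT => nS.
  pose N := [set z | exists a m, J M m /\ z = a * x + m]%classic.
  have MN z : J M z -> N z by move=> Mz; exists 0, z; rewrite mul0r add0r.
  have JN z : J N z -> N z by case=> // Iz; apply: MN; right.
  apply: (Mmax N); last split.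
  - split=> [z Mz|NM]; first by apply: MN; left.
    apply: nx; left; apply: NM; exists 1, 0.
    by rewrite mul1r addr0.
  - move=> a y z /JN[b [m [Mm ->]]] /JN[c [n [Mn ->]]]; left.
    by exists (a * b + c), (a * m + n); split; [exact: Mlin | ring].
  - by move=> z /JN[a [m [Mm zE]]] Sz; apply: nS; exists z, a, m.
have [||||P PE] := @prime_ideal_of_set R (J M) => //.
- by move=> /MS; apply.
- move=> x y Mxy; apply: contrapT => /not_orP[/meet[s [a [m [Ss Mm sE]]]]].
  move=> /meet[t [b [n [St Mn tE]]]].
  apply: (MS (s * t)); last exact: SM.
  rewrite sE tE.
  have -> : (a * x + m) * (b * y + n) =
    (a * b) * (x * y) + ((a * x + m) * n + (b * y) * m) by ring.
  by apply: (Mlin) => //; apply: (Mlin) => //; apply: JM.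
- exists P; split=> [x Ix|x Sx]; first by apply/PE; right.
  by apply/negP => /PE /MS.
Qed.

(** * Independence and algebraicity modulo a prime *)

Section Independence.
Variables (A : comNzRingType) (D : idomainType) (j : {rmorphism D -> A}).
Implicit Types P Q : prime_idealr A.

(** This is injectivity of $D \to A/P$. For [D] a polynomial ring over [K], it means that the values
    of the variables are algebraically independent modulo [P]. *)
Definition independent_mod P := forall d, j d \in P -> d = 0.

Definition eval_at (a : A) : {rmorphism {poly D} -> A} :=
  horner_morph (fun d => mulrC a (j d)).

Definition algebraic_mod P (a : A) :=
  exists2 p : {poly D}, p != 0 & eval_at a p \in P.

Lemma eval_atC a d : eval_at a d%:P = j d.
Proof. exact: horner_morphC. Qed.

Lemma eval_atX a : eval_at a 'X = a.
Proof. exact: horner_morphX. Qed.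

End Independence.

(** Modulo [Q] a relation for [a] reduces to its constant term, which is therefore zero. As [a] is
    not in [P], a factor [a] can be cancelled modulo [P], and the degree drops. *)
Lemma independent_mod_chain (A : comNzRingType) (D : idomainType)
    (j : {rmorphism D -> A}) (P Q : prime_idealr A) (a : A) :
  {subset P <= Q} -> a \in Q -> a \notin P ->
  independent_mod j Q -> independent_mod (eval_at j a) P.
Proof.
move=> PQ Qa Pa jQ; elim/poly_ind => // p c IH.
rewrite rmorphD rmorphM /= eval_atX eval_atC => Pp.
have c0 : c = 0.
  apply: jQ; have := PQ _ Pp.
  by rewrite rpredDl // idealMr.
move: Pp; rewrite c0 rmorph0 addr0 prime_idealrM (negPf Pa) orbF => /IH ->.
by rewrite mul0r addr0.
Qed.

(** Cancelling powers of [f] in a relation for [f] leaves one whose constant term [r] is nonzero;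
    all its other terms are multiples of [f]. *)
Lemma algebraic_mod_divides (A : comNzRingType) (D : idomainType)
    (j : {rmorphism D -> A}) (P : prime_idealr A) (f : A) :
  f \notin P -> algebraic_mod j P f ->
  exists r c, r != 0 /\ j r - c * f \in P.
Proof.
move=> Pf [p]; elim/poly_ind: p => [|p c IH]; first by rewrite eqxx.
rewrite rmorphD rmorphM /= eval_atX eval_atC.
have [-> p0|c0 _ Pp] := eqVneq c 0.
  rewrite rmorph0 addr0 prime_idealrM (negPf Pf) orbF => /IH; apply.
  by apply: contraNneq p0 => ->; rewrite mul0r addr0.
exists c, (- eval_at j f p); split=> //.
by rewrite mulNr opprK addrC.
Qed.

(** * Integrality after inverting an element *)

(* The monic relation satisfied by [l * x] is obtained from that of [x] by
   multiplication with [l ^ (deg p - 1)]. *)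
Lemma integral_lead_coef_mul (R : idomainType) (B : comNzRingType)
    (h : {rmorphism R -> B}) (p : {poly R}) (x : B) :
  p != 0 -> (map_poly h p).[x] = 0 -> integralOver h (h (lead_coef p) * x).
Proof.
move=> p0 px; set l := lead_coef p.
case sp: (size p) => [|[|n]]; first by move: p0; rewrite -size_poly_eq0 sp.
  move: px; have -> : p = l%:P.
    rewrite /l [in RHS](size1_polyC (p := p)) ?sp // lead_coefC.
    by rewrite -size1_polyC ?sp.
  rewrite map_polyC hornerC /= => ->; rewrite mul0r; exact: integral0.
pose q := 'X ^+ n.+1 + \poly_(i < n.+1) (l ^+ (n - i) * p`_i).
exists q.
  by rewrite monicE lead_coefDl ?lead_coefXn // size_polyXn ltnS size_poly.
rewrite /root rmorphD /= map_polyXn hornerD hornerXn.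
rewrite (@horner_coef_wide _ n.+1); last first.
  by apply: leq_trans (size_poly _ _) _; exact: size_poly.
have lp : p`_n.+1 = l by rewrite /l lead_coefE sp.
move: px; rewrite (@horner_coef_wide _ n.+2); last first.
  by rewrite -sp size_poly.
move/(congr1 (fun y => h l ^+ n * y)).
rewrite mulr0 big_ord_recr /= mulrDr => E.
apply/eqP; rewrite -[RHS]E addrC; congr (_ + _).
  rewrite mulr_sumr; apply: eq_bigr => i _.
  rewrite !coef_map coef_poly ltn_ord /= rmorphM rmorphXn exprMn.
  have -> : h l ^+ n = h l ^+ (n - i) * h l ^+ i.
    by rewrite -exprD subnK // -ltnS ltn_ord.
  ring.
by rewrite coef_map /= lp !exprMn exprSr; ring.
Qed.

Section ClearingDenominators.
Variables (R B : comNzRingType) (h : {rmorphism R -> B}) (g : R).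

(* That is, [b] is integral over R[1/g]. *)
Definition integral_away (b : B) := exists N, integralOver h (h g ^+ N * b).

Lemma integral_awayW N M b : (N <= M)%N ->
  integralOver h (h g ^+ N * b) -> integralOver h (h g ^+ M * b).
Proof.
move=> NM iN; rewrite -(subnK NM) exprD -mulrA.
by apply: integral_mul => //; rewrite -rmorphXn; apply: integral_id.
Qed.

Lemma integral_awayD a b :
  integral_away a -> integral_away b -> integral_away (a + b).
Proof.
move=> [N ha] [M hb]; exists (N + M)%N; rewrite mulrDr.
by apply: integral_add; [apply: integral_awayW ha | apply: integral_awayW hb];
  rewrite ?leq_addr ?leq_addl.
Qed.

Lemma integral_awayM a b :
  integral_away a -> integral_away b -> integral_away (a * b).
Proof.
move=> [N ha] [M hb]; exists (N + M)%N.
by rewrite exprD mulrACA; apply: integral_mul.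
Qed.

End ClearingDenominators.

(** Let $u = 1 - Xg$ and let [d] be the degree of a monic equation for $g^N b$. Multiplied by $u^d$,
    it shows that [u] divides $(g^N c)^d$ in $D[X]$. As [u] and [g] are comaximal, [u] divides the
    constant $c^d$; but [u] has positive degree. *)
Lemma not_unit_mul_integral_away (D : idomainType) (B : comNzRingType)
    (h : {rmorphism {poly D} -> B}) (g : {poly D}) (b : B) (c : D) :
  injective h -> g != 0 -> integral_away h g b ->
  h c%:P = h (1 - 'X * g) * b -> c = 0.
Proof.
move=> hinj g0 [N [p pmon proot]] E.
set u := 1 - 'X * g in E.
pose w := g ^+ N * c%:P.
have hw : h w = h u * (h g ^+ N * b).
  by rewrite rmorphM rmorphXn E; ring.
pose d := (size p).-1.
have size_p : size p = d.+1 by rewrite prednK // size_poly_gt0 monic_neq0.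
have [v wv] : exists v, w ^+ d = u * v.
  (* Times $u^d$, the term of index [i] becomes $p_i u^{d-i} w^i$; since $i < d$, a factor [u] can
     be split off. *)
  exists (- \sum_(i < d) p`_i * u ^+ (d - i).-1 * w ^+ i).
  apply: hinj; apply/eqP; rewrite mulrN rmorphN -addr_eq0 -rmorphD.
  move/eqP: proot; rewrite (@horner_coef_wide _ d.+1); last first.
    by rewrite -size_p size_poly.
  move/(congr1 (fun y => h u ^+ d * y)); rewrite mulr0 => <-.
  rewrite big_ord_recr /= mulrDr rmorphD [X in _ == X]addrC; apply/eqP.
  congr (_ + _).
    rewrite coef_map /= -[d]/((size p).-1) -lead_coefE (monicP pmon) rmorph1.
    by rewrite rmorphXn hw exprMn; ring.
  rewrite rmorphM rmorph_sum !mulr_sumr; apply: eq_bigr => i _.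
  rewrite coef_map !rmorphM !rmorphXn hw /= !exprMn.
  have -> : h u ^+ d = h u * h u ^+ (d - i).-1 * h u ^+ i.
    by rewrite -exprS prednK ?subn_gt0 // -exprD subnK // ltnW.
  ring.
(* [u] divides [1 - ('X * g) ^ M], so the power of [g] can be removed. *)
have [v' cv] : exists v', c%:P ^+ d = u * v'.
  pose M := (N * d)%N.
  have XgM : 1 - ('X * g) ^+ M = u * (\sum_(i < M) ('X * g) ^+ i).
    by rewrite -[X in X - _](expr1n _ M) subrXX; congr (_ * _);
       apply: eq_bigr => i _; rewrite expr1n mul1r.
  exists ((\sum_(i < M) ('X * g) ^+ i) * c%:P ^+ d + 'X ^+ M * v).
  have -> : u * ((\sum_(i < M) ('X * g) ^+ i) * c%:P ^+ d + 'X ^+ M * v) =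
    u * (\sum_(i < M) ('X * g) ^+ i) * c%:P ^+ d + 'X ^+ M * (u * v) by ring.
  by rewrite -XgM -wv /w !exprMn -exprM; ring.
apply/eqP; apply: contraT => c0.
have cd0 : c ^+ d != 0 by rewrite expf_neq0.
have size_u : (1 < size u)%N.
  rewrite /u addrC size_polyDl size_polyN mulrC size_mulX // ?size_poly1.
    by rewrite ltnS size_poly_gt0.
  by rewrite ltnS size_poly_gt0.
have v'0 : v' != 0.
  apply: contraNneq cd0 => v'0; move/eqP: cv.
  by rewrite v'0 mulr0 -rmorphXn polyC_eq0.
have := congr1 (fun q : {poly D} => size q) cv.
rewrite -rmorphXn size_polyC cd0 size_mul //; last first.
  by rewrite -size_poly_gt0 ltnW.
move: v'0; rewrite -size_poly_gt0; case: (size u) size_u => [|[|k]] // _.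
by case: (size v') => // m _; rewrite addSn /= addnS.
Qed.

(** * Quotients by primes and generators of affine algebras *)

Lemma prime_quotient (A : comNzRingType) (P : prime_idealr A) :
  exists (B : comNzRingType) (pi : {rmorphism A -> B}),
    forall a, pi a = 0 <-> a \in P.
Proof.
exists {ideal_quot P}, (\pi_{ideal_quot P}) => a.
have -> : (a \in P) = (a == 0 %[mod {ideal_quot P}]).
  by rewrite -Quotient.idealrBE subr0.
by rewrite (rmorph0 (\pi_{ideal_quot P})); split=> /eqP.
Qed.

(** The form of an induction principle reduces integrality of all elements to that of the
    generators. *)
Definition generates (K : fieldType) (A : comAlgType K) (s : seq A) :=
  forall M : A -> Prop, (forall c : K, M c%:A) -> {in s, forall x, M x} ->
    (forall x y, M x -> M y -> M (x + y)) ->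
    (forall x y, M x -> M y -> M (x * y)) -> forall a, M a.

Lemma affine_generates (K : fieldType) (A : comAlgType K) :
  affine_algebra A -> exists s : seq A, generates s.
Proof.
case=> n [phi phi_surj].
exists [seq phi 'X_i | i <- enum 'I_n] => M MK Ms MD MM a.
have M1 : M 1 by rewrite -[1]scale1r; apply: MK.
have M0 : M 0 by rewrite -[0](scale0r (1 : A)); apply: MK.
have [p <-] := phi_surj a; rewrite [p]mpolyE rmorph_sum /=.
apply: (big_ind M) => // m _.
rewrite linearZ /= -[phi _]mul1r scalerAl; apply: (MM); first exact: MK.
rewrite mpolyXE_id rmorph_prod; apply: (big_ind M) => // i _.
rewrite rmorphXn; elim: (m i) => [|k IH]; first by rewrite expr0.
rewrite exprS; apply: MM => //; apply: Ms.
by apply: map_f; rewrite mem_enum.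
Qed.

(** [g] is [r] times the leading coefficients of relations for the members of [s]; inverting it
    makes these relations monic. The factor [r] later keeps [f] out of the new prime. *)
Lemma integral_away_gens (R : idomainType) (A B : comNzRingType)
    (J : {rmorphism R -> A}) (P : prime_idealr A) (pi : {rmorphism A -> B})
    (s : seq A) (r : R) :
  (forall a, pi a = 0 <-> a \in P) -> r != 0 ->
  {in s, forall x, algebraic_mod J P x} ->
  exists2 g, g != 0 & (exists g', g = r * g') /\
    {in s, forall x, integral_away (pi \o J) g (pi x)}.
Proof.
move=> piP r0; elim: s => [|x s IH] alg_s.
  by exists r => //; split=> //; exists 1; rewrite mulr1.
have [|g g0 [[g' gE] intg]] := IH.
  by move=> y ys; apply: alg_s; rewrite inE ys orbT.
have [|p p0 px] := alg_s x; first exact: mem_head.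
exists (g * lead_coef p); first by rewrite mulf_neq0 // lead_coef_eq0.
split=> [|y]; first by exists (g' * lead_coef p); rewrite gE mulrA.
rewrite inE => /predU1P[->|/intg[N intN]].
  exists 1%N; rewrite expr1 rmorphM -mulrA; apply: integral_mul.
    exact: integral_id.
  apply: integral_lead_coef_mul => //.
  by rewrite map_poly_comp horner_map; apply/piP.
exists N; rewrite rmorphM exprMn mulrAC mulrC; apply: integral_mul => //.
by rewrite -rmorphXn; apply: integral_id.
Qed.

(** * Trading one independent variable for a strictly larger prime *)

Lemma prime_step (K : fieldType) (A : comAlgType K) (s : seq A)
    (D : idomainType) (j : {rmorphism D -> A}) (a f : A)
    (P : prime_idealr A) :
  generates s -> (forall c : K, exists d, j d = c%:A) ->
  f \notin P -> independent_mod (eval_at j a) P ->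
  {in f :: s, forall x, algebraic_mod (eval_at j a) P x} ->
  exists Q : prime_idealr A, [/\ {subset P <= Q}, ~ {subset Q <= P},
    f \notin Q & independent_mod j Q].
Proof.
move=> gen_s jK Pf indP alg_s.
set J := eval_at j a in indP alg_s.
have [r [c [r0 rcf]]] := algebraic_mod_divides Pf (alg_s f (mem_head _ _)).
have [B [pi piP]] := prime_quotient P.
have [|g g0 [[g' gE] intg]] := @integral_away_gens _ _ _ J P pi s r piP r0.
  by move=> x xs; apply: alg_s; rewrite inE xs orbT.
pose h : {rmorphism {poly D} -> B} := pi \o J.
have hinj : injective h.
  move=> p q /eqP; rewrite -subr_eq0 -rmorphB => /eqP /piP /indP /eqP.
  by rewrite subr_eq0 => /eqP.
have int_all b : integral_away h g (pi b).
  apply: (gen_s (fun b => integral_away h g (pi b))) => [k|x xs|x y|x y].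
  - have [d <-] := jK k; exists 0%N; rewrite expr0 mul1r -(eval_atC j a).
    exact: (integral_id h).
  - exact: intg.
  - by rewrite rmorphD; apply: integral_awayD.
  - by rewrite rmorphM; apply: integral_awayM.
pose u : {poly D} := 1 - 'X * g.
pose I : set A := [set x | exists b p, p \in P /\ x = J u * b + p]%classic.
pose S : set A := [set x | exists2 d, d != 0 & x = j d]%classic.
have I0 : I 0 by exists 0, 0; rewrite mulr0 addr0 idealr0.
have S1 : S 1 by exists 1; rewrite ?oner_neq0 ?rmorph1.
have [|x y|x|Q [IQ SQ]] := prime_ideal_avoiding I0 _ S1.
- move=> k x y [b [p [Pp ->]]] [b' [q [Pq ->]]].
  exists (k * b + b'), (k * p + q); split; last by ring.
  by rewrite rpredD // idealMr.
- move=> [d d0 ->] [e e0 ->].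
  by exists (d * e); rewrite ?mulf_neq0 // rmorphM.
(* A common element gives $d = ub$ in $A/P$ with [b] integral over $D[X][1/g]$, which forces $d =
   0$. *)
- move=> [b [p [Pp xE]]] [d d0 xd]; move/eqP: d0; apply.
  apply: (not_unit_mul_integral_away hinj g0 (int_all b)).
  rewrite /h /= eval_atC -xd xE rmorphD rmorphM /=.
  by rewrite (piP p).2 // addr0.
have Qu : J u \in Q.
  by apply: IQ; exists 1, 0; rewrite mulr1 addr0 idealr0.
have PQ : {subset P <= Q}.
  by move=> x Px; apply: IQ; exists 0, x; rewrite mulr0 add0r.
exists Q; split=> //.
(* If [u] were in [P], it would be zero by independence, but its value at $X = 0$ is 1. *)
- move=> /(_ _ Qu) /indP u0.
  have /eqP := congr1 (fun p => p.[0]) u0.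
  by rewrite !hornerE ?mul0r ?mulr0 ?subr0 oner_eq0.
- apply/negP => Qf; have := idealr1 Q.
  (* Here $1 = u + Xg$, $g = r g'$ and $r \equiv cf$ modulo [P], so $f \in Q$ would give $1 \in
     Q$. *)
  have -> : 1 = J u + J 'X * J g' * ((J r - c * f) + c * f).
    by rewrite subrK /u gE rmorphB rmorph1 !rmorphM; ring.
  by rewrite rpredD // idealMr // rpredD ?idealMr // PQ.
- move=> d Qd; apply/eqP; apply: contraT => d0.
  by have := SQ (j d); rewrite Qd; apply; exists d.
Qed.

(** * Independent families and chains of primes *)

Section Tower.
Variables (K : fieldType) (A : comAlgType K).
Implicit Types (s t : seq A) (P Q : prime_idealr A).

(** Variables are adjoined one at a time, since [prime_step] gives up exactly the outermost one. *)
Fixpoint iter_poly (n : nat) : idomainType :=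
  if n is m.+1 then {poly iter_poly m} else K.

(* The head of the list is the value of the outermost variable. *)
Fixpoint ev s : {rmorphism iter_poly (size s) -> A} :=
  match s return {rmorphism iter_poly (size s) -> A} with
  | [::] => in_alg A
  | a :: s' => eval_at (ev s') a
  end.

Lemma ev_scalar s (c : K) : exists d, ev s d = c%:A.
Proof.
elim: s => [|a s [d dE]]; first by exists c.
by exists d%:P; rewrite -dE; apply: eval_atC.
Qed.

Lemma algebraic_mod_weaken (D : idomainType) (j : {rmorphism D -> A}) P y x :
  algebraic_mod j P x -> algebraic_mod (eval_at j y) P x.
Proof.
move=> [p p0 px]; exists (map_poly polyC p).
  by rewrite map_poly_eq0_id0 // polyC_eq0 lead_coef_eq0.
suff -> : eval_at (eval_at j y) x (map_poly polyC p) = eval_at j x p by [].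
change ((map_poly (eval_at j y) (map_poly polyC p)).[x] = (map_poly j p).[x]).
rewrite -map_poly_comp; congr _.[x].
by apply: eq_map_poly => d /=; apply: eval_atC.
Qed.

(** Each member of [gens] that is not yet algebraic is adjoined as a new variable, which preserves
    independence. *)
Lemma extend_independent (gens s : seq A) P :
  independent_mod (ev s) P ->
  exists t, [/\ (size s <= size t)%N, independent_mod (ev t) P &
    {in gens, forall x, algebraic_mod (ev t) P x}].
Proof.
move=> ind_s; elim: gens => [|x gens [t [st ind_t alg_t]]].
  by exists s; split.
have [alg_x|nalg_x] := pselect (algebraic_mod (ev t) P x).
  exists t; split=> // y; rewrite inE => /predU1P[->|]//.
  exact: alg_t.
exists (x :: t); split; first exact: leqW.
  move=> p Pp; apply/eqP; apply: contraT => p0.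
  by case: nalg_x; exists p.
move=> y; rewrite inE => /predU1P[->|/alg_t]; last exact: algebraic_mod_weaken.
(* The inner ['X] is the new variable, whose value is [x]. *)
exists ('X - 'X%:P); first by rewrite polyXsubC_eq0.
rewrite rmorphB /= eval_atX eval_atC; set X := (X in x - X).
suff -> : X = x by rewrite subrr idealr0.
exact: eval_atX.
Qed.

Definition strict_chain (R : comNzRingType) (n : nat)
    (C : nat -> prime_idealr R) :=
  forall i, (i < n)%N ->
    {subset C i <= C i.+1} /\ ~ {subset C i.+1 <= C i}.

(** Induction from the top of the chain: to a family independent modulo $C_1$ an element of $C_1
    \setminus C_0$ is added. *)
Lemma strict_chain_independent n (C : nat -> prime_idealr A) :
  strict_chain n C ->
  exists s, size s = n /\ independent_mod (ev s) (C 0%N).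
Proof.
elim: n C => [|n IH] C chC.
  exists [::]; split=> // c /= Cc; apply/eqP; apply: contraT => c0.
  have := idealr1 (C 0%N).
  (* A nonzero scalar is a unit, so it lies in no prime. *)
  have -> : 1 = c^-1%:A * c%:A :> A.
    by rewrite -scalerAl mul1r scalerA mulVf // scale1r.
  by rewrite idealMr.
have [|s [sn ind_s]] := IH (C \o S); first by move=> i /(chC i.+1).
have [sub nsub] := chC 0%N isT.
have [a [C1a C0a]] : exists a, a \in C 1%N /\ a \notin C 0%N.
  apply: contrapT => na; apply: nsub => x C1x; apply: contraT => C0x.
  by case: na; exists x.
exists (a :: s); split; first by rewrite /= sn.
exact: (independent_mod_chain sub C1a C0a ind_s).
Qed.

(** After extension to a maximal family, [prime_step] costs one variable and yields the next prime;
    at least [n] variables remain for the induction. *)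
Lemma independent_strict_chain (gens : seq A) (f : A) n s P :
  generates gens -> f \notin P -> (n <= size s)%N ->
  independent_mod (ev s) P ->
  exists C, [/\ C 0%N = P, strict_chain n C & forall i, f \notin C i].
Proof.
move=> gen_A; elim: n s P => [|n IH] s P Pf ns ind_s.
  by exists (fun=> P).
have [t [st ind_t alg_t]] := extend_independent (f :: gens) ind_s.
case: t => [|a t] in st ind_t alg_t; first by have := leq_trans ns st.
have [Q [PQ nQP Qf ind_Q]] :=
  prime_step gen_A (ev_scalar t) Pf ind_t alg_t.
have [|C [C0 chC Cf]] := IH t Q Qf _ ind_Q; first exact: leq_trans ns st.
exists (fun i => if i is k.+1 then C k else P); split=> //.
  by case=> [_|i /(chC i)//]; rewrite C0.
by case.
Qed.

(** The products of a power of [f] and a nonzero polynomial in the family form a multiplicative set.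
    It misses 0 because [f] can be cancelled and the family is independent modulo [P]. *)
Lemma independent_avoid (f : A) s P :
  (forall a, f * a = 0 -> a = 0) -> independent_mod (ev s) P ->
  exists Q : prime_idealr A, f \notin Q /\ independent_mod (ev s) Q.
Proof.
move=> hf ind_s.
have hfk k (a : A) : f ^+ k * a = 0 -> a = 0.
  elim: k => [|k IH]; first by rewrite expr0 mul1r.
  by rewrite exprS -mulrA => /hf.
pose I : set A := [set 0]%classic.
pose S : set A :=
  [set x | exists d k, d != 0 /\ x = f ^+ k * ev s d]%classic.
have S1 : S 1 by exists 1, 0%N; rewrite oner_neq0 rmorph1 mulr1.
have [//|a x y -> ->|x y|x ->|Q [_ SQ]] := @prime_ideal_avoiding _ I S _ _ S1.
- by rewrite mulr0 addr0.
- move=> [d [k [d0 ->]]] [e [l [e0 ->]]]; exists (d * e), (k + l)%N.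
  by rewrite mulf_neq0 // rmorphM exprD mulrACA.
- move=> [d [k [d0 /esym /hfk dE]]]; move/eqP: d0; apply.
  by apply: ind_s; rewrite dE idealr0.
exists Q; split.
  by apply: SQ; exists 1, 1%N; rewrite oner_neq0 rmorph1 mulr1.
move=> d Qd; apply/eqP; apply: contraT => d0.
by have := SQ (ev s d); rewrite Qd; apply; exists d, 0%N; rewrite expr0 mul1r.
Qed.

End Tower.

(** * Chains of primes in the localization *)

Lemma chain_lengthsP (R : comNzRingType) d :
  chain_lengths R d <->
  exists n C, @strict_chain R n C /\ d = (n%:Z)%:E%E.
Proof.
split=> [[n [P [chP ->]]]|[n [C [chC ->]]]].
  exists n, (fun i => P (inord i)); split=> // i ltin.
  by apply: chP; rewrite !inordK // ltnW.
exists n, (fun i => C i); split=> // i j ij.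
have sub k l : (k <= l <= n)%N -> {subset C k <= C l}.
  elim: l => [|l IH] /andP[kl ln]; first by move: kl; rewrite leqn0 => /eqP ->.
  move: kl; rewrite leq_eqVlt => /predU1P[->//|kl] x Cx.
  by apply: (chC l ln).1; apply: IH => //; rewrite -ltnS kl ltnW.
have jn : (j <= n)%N by rewrite -ltnS.
split; first by apply: sub; rewrite ltnW.
have [_ ns] := chC i (leq_trans ij jn) => ji; apply: ns => x Cx.
by apply: ji; apply: (sub i.+1 j) => //; rewrite ij.
Qed.

Section AwayPrimes.
Variables (R : comNzRingType) (f : R) (hf : nonnilpotent f).
Local Notation frac := (@away_frac R f hf).

Lemma away_frac_split a t : frac a t = frac a 0 * frac 1 t.
Proof. by rewrite away_fracM mulr1. Qed.

Lemma away_frac_unit a t : frac a 0 = frac (f ^+ t) 0 * frac a t.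
Proof.
by rewrite away_fracM; apply: away_frac_congr; rewrite expr0 mul1r.
Qed.

Lemma away_contraction (P : prime_idealr (away hf)) :
  exists Q : prime_idealr R, forall a t, a \in Q <-> frac a t \in P.
Proof.
have [||||Q QE] := @prime_ideal_of_set R [set a | frac a 0 \in P]%classic.
- by rewrite /= away_frac0 idealr0.
- by rewrite /= away_frac1 idealr1.
- move=> a x y /= Px Py.
  have -> : frac (a * x + y) 0 = frac a 0 * frac x 0 + frac y 0.
    rewrite away_fracM away_fracD; congr frac.
    by rewrite !expr0 !mul1r.
  by rewrite rpredD // idealMr.
- move=> x y /=; have -> : frac (x * y) 0 = frac x 0 * frac y 0.
    by rewrite away_fracM.
  by rewrite prime_idealrM => /orP.
exists Q => a t; rewrite QE /=; split=> Pa.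
  by rewrite away_frac_split mulrC idealMr.
by rewrite (away_frac_unit _ t) idealMr.
Qed.

Lemma away_extension (P : prime_idealr R) : f \notin P ->
  exists Q : prime_idealr (away hf), forall a t, a \in P <-> frac a t \in Q.
Proof.
move=> Pf.
have PfM t a : f ^+ t * a \in P -> a \in P.
  elim: t => [|t IH]; first by rewrite expr0 mul1r.
  by rewrite exprS -mulrA prime_idealrM (negPf Pf).
(* All representations of [u] are quantified over, so no representative is chosen; by [IE] a single
   one decides. *)
pose I : set (away hf) := [set u | forall a t, u = frac a t -> a \in P]%classic.
have IE a t : I (frac a t) <-> a \in P.
  split=> [|Pa b k /away_frac_eq[s E]]; first exact.
  apply: (PfM t); apply: (PfM s); move/eqP: E.
  rewrite mulrBr subr_eq0 => /eqP <-.
  by rewrite !idealMr.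
have [||||Q QE] := @prime_ideal_of_set _ I.
- by rewrite -away_frac0; apply/IE; exact: idealr0.
- by rewrite -away_frac1 => /IE; rewrite idealr1.
- elim/away_fracW=> a k; elim/away_fracW=> x m; elim/away_fracW=> y n.
  move=> /IE Px /IE Py; rewrite away_fracM away_fracD; apply/IE.
  by rewrite rpredD // ?idealMr.
- elim/away_fracW=> x m; elim/away_fracW=> y n.
  rewrite away_fracM => /IE; rewrite prime_idealrM => /orP[] Pz.
    by left; apply/IE.
  by right; apply/IE.
by exists Q => a t; rewrite QE IE.
Qed.

End AwayPrimes.

Theorem theorem2p7 (K : fieldType) (A : comAlgType K)
    (hA : affine_algebra A) (f : A)
    (hf : forall a : A, f * a = 0 -> a = 0) :
  krull_dim (away (non_zero_divisor_nonnilpotent hf)) = krull_dim A.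
Proof.
set hn := non_zero_divisor_nonnilpotent hf.
suff E : chain_lengths (away hn) = chain_lengths A by rewrite /krull_dim E.
apply/seteqP; split=> d /chain_lengthsP[n [C [chC ->]]]; apply/chain_lengthsP.
  (* A chain in the localization contracts to one of the same length in [A]. *)
  have [C' C'E] := choice (fun i => away_contraction (C i)).
  exists n, C'; split=> // i /chC[sub nsub]; split.
    by move=> a /(C'E i a 0%N)/sub/(C'E i.+1 a 0%N).
  move=> sub'; apply: nsub; elim/away_fracW=> a t.
  by move=> /(C'E i.+1 a t)/sub'/(C'E i a t).
(* A chain in [A] may meet [f], so it is replaced, through independent elements, by one of the same
   length whose primes avoid [f]; that one extends to the localization. *)
have [s [sn ind_s]] := strict_chain_independent chC.
have [P [Pf ind_P]] := independent_avoid hf ind_s.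
have [gens gen_A] := affine_generates hA.
have [|C1 [_ chC1 C1f]] := independent_strict_chain gen_A Pf _ ind_P (n := n).
  by rewrite sn.
have [C' C'E] := choice (fun i => away_extension hn (C1f i)).
exists n, C'; split=> // i /chC1[sub nsub]; split.
  elim/away_fracW=> a t.
  by move=> /(C'E i a t)/sub/(C'E i.+1 a t).
move=> sub'; apply: nsub => a.
by move=> /(C'E i.+1 a 0%N)/sub'/(C'E i a 0%N).
Qed.
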